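(* Let $k\ge 2$ be an integer, let $A$ be a unital $C^*$-algebra, and let $\alpha$ be a free action of $\mathbb{Z}/k\mathbb{Z}$ on $A$. Suppose $\phi_1: A\to A$ is an $\alpha$-equivariant unital $*$-homomorphism, i.e. $\phi_1\circ\alpha_g=\alpha_g\circ\phi_1$ for all $g\in\mathbb{Z}/k\mathbb{Z}$. Then there does not exist a family $(\phi_t)_{t\in[0,1]}$ of unital $*$-homomorphisms $\phi_t:A\to A$ such that $t\mapsto \phi_t(a)$ is norm-continuous for every $a\in A$, $\phi_1$ is the given map, and $\phi_0$ is a one-dimensional representation, i.e. $\phi_0(A)\subseteq \mathbb{C}1_A$ (so $\phi_0$ is a unital $*$-homomorphism $A\to\mathbb{C}$).
   Context: An action of $\mathbb{Z}/k\mathbb{Z}$ on a unital $C^*$-algebra $A$ is a group homomorphism $g\mapsto\alpha_g$ into $\mathrm{Aut}(A)$; it is determined by the automorphism $\alpha=\alpha_1$ with $\alpha^k=\mathrm{id}$. The action is called free if the associated coaction $\delta:A\to A\otimes C(\mathbb{Z}/k\mathbb{Z})\cong C(\mathbb{Z}/k\mathbb{Z},A)$, $\delta(a)(g)=\alpha_g(a)$, satisfies the Ellwood condition: the closed linear span of $\{(a\otimes 1)\delta(b): a,b\in A\}$ equals $A\otimes C(\mathbb{Z}/k\mathbb{Z})$. Equivalently, the action is saturated: for every $k$th root of unity $\lambda$, the spectral subspace $A_\lambda=\{a\in A:\alpha(a)=\lambda a\}$ satisfies $A=\overline{\mathrm{span}}\,(A_\lambda^*AA_\lambda)$; equivalently,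 the $\mathbb{Z}/k\mathbb{Z}$-grading $A=\bigoplus_m A_m$ by spectral subspaces is strong, $A_mA_n=A_{m+n}$ for all $m,n$. *)

(* Defs.v *)
From Stdlib Require Import Reals List.
Open Scope R_scope.

Record Cx := mkCx { Cre : R; Cim : R }.
Definition C0 : Cx := mkCx 0 0.
Definition C1 : Cx := mkCx 1 0.
Definition Cadd (z w : Cx) : Cx := mkCx (Cre z + Cre w) (Cim z + Cim w).
Definition Cmul (z w : Cx) : Cx :=
  mkCx (Cre z * Cre w - Cim z * Cim w) (Cre z * Cim w + Cim z * Cre w).
Definition Cconj (z : Cx) : Cx := mkCx (Cre z) (- Cim z).
Definition Cabs (z : Cx) : R := sqrt (Cre z * Cre z + Cim z * Cim z).

Record CstarAlg := {
  car :> Type;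
  zero : car;
  one : car;
  add : car -> car -> car;
  opp : car -> car;
  mul : car -> car -> car;
  scal : Cx -> car -> car;
  star : car -> car;
  norm : car -> R;
  addA : forall a b c, add a (add b c) = add (add a b) c;
  addC : forall a b, add a b = add b a;
  add0 : forall a, add a zero = a;
  addN : forall a, add a (opp a) = zero;
  scal_addl : forall c d a, scal (Cadd c d) a = add (scal c a) (scal d a);
  scal_addr : forall c a b, scal c (add a b) = add (scal c a) (scal c b);
  scal_mul : forall c d a, scal (Cmul c d) a = scal c (scal d a);
  scal1 : forall a, scal C1 a = a;
  mulA : forall a b c, mul a (mul b c) = mul (mul a b) c;
  mul1l : forall a, mul one a = a;
  mul1r : forall a, mul a one = a;
  mul_addl : forall a b c, mul (add a b) c = add (mul a c) (mul b c);
  mul_addr : forall a b c, mul a (add b c) = add (mul a b) (mul a c);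
  mul_scall : forall c a b, mul (scal c a) b = scal c (mul a b);
  mul_scalr : forall c a b, mul a (scal c b) = scal c (mul a b);
  star_star : forall a, star (star a) = a;
  star_add : forall a b, star (add a b) = add (star a) (star b);
  star_scal : forall c a, star (scal c a) = scal (Cconj c) (star a);
  star_mul : forall a b, star (mul a b) = mul (star b) (star a);
  norm_eq0 : forall a, norm a = 0 -> a = zero;
  norm_triangle : forall a b, norm (add a b) <= norm a + norm b;
  norm_scal : forall c a, norm (scal c a) = Cabs c * norm a;
  norm_mul : forall a b, norm (mul a b) <= norm a * norm b;
  norm_cstar : forall a, norm (mul (star a) a) = norm a * norm a;
  complete : forall u : nat -> car,
    (forall eps, 0 < eps -> exists N, forall m n, (N <= m)%nat -> (N <= n)%nat ->
        norm (add (u m) (opp (u n))) < eps) ->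
    exists l, forall eps, 0 < eps -> exists N, forall n, (N <= n)%nat ->
        norm (add (u n) (opp l)) < eps;
  one_neq0 : one <> zero
}.

Arguments zero {_}. Arguments one {_}. Arguments add {_} _ _.
Arguments opp {_} _. Arguments mul {_} _ _. Arguments scal {_} _ _.
Arguments star {_} _. Arguments norm {_} _.

Definition sub {A : CstarAlg} (a b : A) : A := add a (opp b).

Definition unital_star_hom {A : CstarAlg} (f : A -> A) : Prop :=
  (forall a b, f (add a b) = add (f a) (f b)) /\
  (forall c a, f (scal c a) = scal c (f a)) /\
  (forall a b, f (mul a b) = mul (f a) (f b)) /\
  (forall a, f (star a) = star (f a)) /\
  f one = one.

Definition star_automorphism {A : CstarAlg} (f : A -> A) : Prop :=
  unital_star_hom f /\
  (forall a b, f a = f b -> a = b) /\ (forall b, exists a, f a = b).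

(** alpha_g := alpha^g for g in Z/kZ = {0,...,k-1} *)
Definition act {A : CstarAlg} (alpha : A -> A) (g : nat) (a : A) : A :=
  Nat.iter g alpha a.

(** an action of Z/kZ on A, given by its generator alpha = alpha_1 *)
Definition Zk_action {A : CstarAlg} (k : nat) (alpha : A -> A) : Prop :=
  star_automorphism alpha /\ (forall a, act alpha k a = a).

(** The element  sum_i c_i (a_i ⊗ 1) δ(b_i)  of A ⊗ C(Z/kZ) ≅ C(Z/kZ, A),
    evaluated at g, for a finite list of triples (c_i, a_i, b_i). *)
Definition ellwood_elt {A : CstarAlg} (alpha : A -> A)
  (l : list (Cx * A * A)) (g : nat) : A :=
  fold_right (fun t acc =>
     let '(c, a, b) := t in add (scal c (mul a (act alpha g b))) acc) zero l.

(** Freeness (Ellwood condition): the closed linear span of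
    {(a ⊗ 1) δ(b)} is all of A ⊗ C(Z/kZ) ≅ C(Z/kZ, A) = A^k with the
    sup norm.  (The inclusion "⊆" is automatic.) *)
Definition free_action {A : CstarAlg} (k : nat) (alpha : A -> A) : Prop :=
  forall (F : nat -> A) (eps : R), 0 < eps ->
    exists l : list (Cx * A * A),
      forall g, (g < k)%nat -> norm (sub (F g) (ellwood_elt alpha l g)) < eps.

(* Main.v *)
(** Pulling characters of [A] back along [phi_t] contracts the character space
    [X] to a point through maps ending at a map [f] that commutes with the
    rotation [T chi = chi o alpha]; the Ellwood condition, evaluated at
    characters, makes the [Z/k]-action on [X] uniformly free.  This is impossible
    by a cochain-level Borsuk-Ulam argument.

    On the one hand, small simplices of [X] carry cochains obtained from
    equivariant maps [s : X -> Z/k]: the 2-cocycles [carry_class s], which all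
    represent the Euler class of [Z/k].  Covering [X] by finitely many pieces near each
    of which some [s] is locally constant, the cup product of these 2-cocycles
    vanishes on every sufficiently small simplex.

    On the other hand, the contraction yields small chains
    [c_0 = [x0], c_1, c_2, ...] with [d c_(2j+1) = (T - 1) f c_(2j)] and
    [d c_(2j) = (1 + T + ... + T^(k-1)) f c_(2j-1)] (a model of the infinite lens
    space), on which every product of [n] of the cocycles takes the value
    [+1] or [-1] modulo [k]. *)

Require Import Defs.
From Stdlib Require Import Reals List ZArith Lia Psatz.
From Stdlib Require Import ClassicalEpsilon FunctionalExtensionality ProofIrrelevance.
Import ListNotations.
Open Scope R_scope.

(** * Ordered integer cochains and prism operators *)

Section Cochains.
Context {X : Type}.
Local Open Scope Z_scope.

(** Coboundary of the augmented ordered cochain complex: a list of length [n + 1]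
    is an [n]-simplex, and the empty list is the augmentation degree. *)
Fixpoint cobd (phi : list X -> Z) (l : list X) : Z :=
  match l with
  | [] => 0
  | x :: l' => phi l' - cobd (fun m => phi (x :: m)) l'
  end.

Lemma cobd_ext (phi psi : list X -> Z) (l : list X) :
  (forall m, phi m = psi m) -> cobd phi l = cobd psi l.
Proof.
  revert phi psi; induction l as [|x l IH]; intros phi psi H; simpl; [easy|].
  rewrite H. f_equal. apply IH. intros m; apply H.
Qed.

Lemma cobd_lin (a b : Z) (phi psi : list X -> Z) (l : list X) :
  cobd (fun m => a * phi m + b * psi m) l = a * cobd phi l + b * cobd psi l.
Proof.
  revert phi psi; induction l as [|x l IH]; intros phi psi; simpl; [ring|].
  rewrite (IH (fun m => phi (x :: m)) (fun m => psi (x :: m))). ring.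
Qed.

Lemma cobd_scal (a : Z) (phi : list X -> Z) (l : list X) :
  cobd (fun m => a * phi m) l = a * cobd phi l.
Proof.
  rewrite (cobd_ext _ (fun m => a * phi m + 0 * phi m)) by (intros; ring).
  rewrite cobd_lin; ring.
Qed.

Lemma cobd_sub (phi psi : list X -> Z) (l : list X) :
  cobd (fun m => phi m - psi m) l = cobd phi l - cobd psi l.
Proof.
  rewrite (cobd_ext _ (fun m => 1 * phi m + (-1) * psi m)) by (intros; ring).
  rewrite cobd_lin; ring.
Qed.

Lemma cobd_zero (l : list X) : cobd (fun _ => 0) l = 0.
Proof. rewrite (cobd_scal 0 (fun _ => 0)). ring. Qed.

Lemma cobd_cobd (phi : list X -> Z) (l : list X) : cobd (cobd phi) l = 0.
Proof.
  revert phi; induction l as [|x l IH]; intros phi; simpl; [easy|].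
  rewrite cobd_sub, IH. ring.
Qed.

Lemma cobd_map (u : X -> X) (phi : list X -> Z) (l : list X) :
  cobd (fun m => phi (map u m)) l = cobd phi (map u l).
Proof.
  revert phi; induction l as [|x l IH]; intros phi; simpl; [easy|].
  now rewrite (IH (fun m => phi (u x :: m))).
Qed.

(** Dual of the prism operator: the alternating sum of [phi] over the simplices
    [u x_0, ..., u x_i, v x_i, ..., v x_n]. *)
Fixpoint prism (u v : X -> X) (phi : list X -> Z) (l : list X) : Z :=
  match l with
  | [] => 0
  | x :: l' => phi (u x :: v x :: map v l')
               - prism u v (fun m => phi (u x :: m)) l'
  end.

Lemma prism_ext (u v : X -> X) (phi psi : list X -> Z) (l : list X) :
  (forall m, phi m = psi m) -> prism u v phi l = prism u v psi l.
Proof.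
  revert phi psi; induction l as [|x l IH]; intros phi psi H; simpl; [easy|].
  rewrite H. f_equal. apply IH. intros m; apply H.
Qed.

Lemma prism_lin (u v : X -> X) (a b : Z) (phi psi : list X -> Z) (l : list X) :
  prism u v (fun m => a * phi m + b * psi m) l
  = a * prism u v phi l + b * prism u v psi l.
Proof.
  revert phi psi; induction l as [|x l IH]; intros phi psi; simpl; [ring|].
  rewrite (IH (fun m => phi (u x :: m)) (fun m => psi (u x :: m))). ring.
Qed.

Lemma prism_sub (u v : X -> X) (phi psi : list X -> Z) (l : list X) :
  prism u v (fun m => phi m - psi m) l = prism u v phi l - prism u v psi l.
Proof.
  rewrite (prism_ext _ _ _ (fun m => 1 * phi m + (-1) * psi m)) by (intros; ring).
  rewrite prism_lin; ring.
Qed.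

(** Induction on the first vertex, with [phi] replaced by [fun m => phi (u x :: m)]; the terms
    containing both [u x] and [v x] cancel between the two summands by [cobd_map]. *)
Lemma prism_homotopy (u v : X -> X) (phi : list X -> Z) (l : list X) :
  cobd (prism u v phi) l + prism u v (cobd phi) l
  = phi (map v l) - phi (map u l).
Proof.
  revert phi; induction l as [|x l IH]; intros phi; simpl; [ring|].
  specialize (IH (fun m => phi (u x :: m))).
  rewrite cobd_sub, prism_sub.
  rewrite (cobd_map v (fun m => phi (u x :: v x :: m))).
  cbv beta in IH.
  change (cobd (fun m => prism u v (fun m => phi (u x :: m)) m) l)
    with (cobd (prism u v (fun m => phi (u x :: m))) l).
  change (prism u v (fun m => cobd (fun m => phi (u x :: m)) m) l)
    with (prism u v (cobd (fun m => phi (u x :: m))) l).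
  lia.
Qed.

(** Cochains pulled back along a constant map depend on the length alone; this later removes the end
    [x0] of the contraction. *)
Lemma prism_length (u v : X -> X) (phi : list X -> Z) (l l' : list X) :
  (forall m m', length m = length m' -> phi m = phi m') ->
  length l = length l' -> prism u v phi l = prism u v phi l'.
Proof.
  revert phi l'; induction l as [|x l IH]; intros phi [|x' l'] H E;
    simpl in *; try discriminate; [easy|].
  injection E as E. f_equal.
  - apply H; simpl; now rewrite !length_map, E.
  - rewrite (prism_ext u v _ (fun m => phi (u x' :: m))).
    + apply IH; [|easy]. intros m m' E'; apply H; simpl; now rewrite E'.
    + intros m; apply H; easy.
Qed.

(** * Small simplices and chain-level contractions *)

Definition small (E : X -> X -> Prop) (l : list X) : Prop := ForallOrdPairs E l.

Definition vanish (E : X -> X -> Prop) (phi : list X -> Z) : Prop :=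
  forall l, small E l -> phi l = 0.

Lemma small_map (E E' : X -> X -> Prop) (u : X -> X) (l : list X) :
  (forall x y, E' x y -> E (u x) (u y)) -> small E' l -> small E (map u l).
Proof.
  intros H; unfold small; induction 1 as [|x l Hx Hl IH]; simpl; constructor; auto.
  apply Forall_map. revert Hx; apply Forall_impl; auto.
Qed.

Lemma prism_vanish (E E' : X -> X -> Prop) (u v : X -> X) (phi : list X -> Z) :
  (forall x, E' x x) ->
  (forall x y, E' x y -> E (u x) (u y) /\ E (u x) (v y) /\ E (v x) (v y)) ->
  vanish E phi -> vanish E' (prism u v phi).
Proof.
  intros Hr HE Hphi l Hl.
  (* The recursion fixes leading vertices inside [phi], so the new cochain is only known to vanish
     on small lists made of images of the remaining vertices; the induction carries this weaker
     hypothesis. *)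
  assert (G : forall phi : list X -> Z,
    (forall m, small E m ->
       Forall (fun y => exists z, In z l /\ (y = u z \/ y = v z)) m -> phi m = 0) ->
    prism u v phi l = 0).
  { clear phi Hphi. induction Hl as [|x l Hx Hl IH]; intros phi Hphi; simpl; [easy|].
    rewrite Forall_forall in Hx.
    rewrite Hphi, IH; [easy| |  |].
    - intros m Hm Hml. apply Hphi.
      + constructor; [|easy]. revert Hml; apply Forall_impl.
        intros y (z & Hz & [-> | ->]); apply HE; auto.
      + constructor; [exists x; simpl; auto|].
        revert Hml; apply Forall_impl. intros y (z & Hz & Hy); exists z; simpl; auto.
    - constructor; [|constructor].
      + constructor; [now apply HE|]. apply Forall_map, Forall_forall.
        intros z Hz; apply HE; auto.
      + apply Forall_map, Forall_forall. intros z Hz; apply HE; auto.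
      + apply small_map with E'; [|easy]. intros; now apply HE.
    - constructor; [exists x; simpl; auto|].
      constructor; [exists x; simpl; auto|].
      apply Forall_map, Forall_forall. intros z Hz; exists z; simpl; auto. }
  apply G. intros m Hm _; now apply Hphi.
Qed.

(** [ctr_vanish] is the dual form of: [H] sends [E']-small simplices to [E]-small
    chains. *)
Record contraction (f : X -> X) (x0 : X) (E' E : X -> X -> Prop)
  (H : (list X -> Z) -> list X -> Z) : Prop := {
  ctr_ext : forall phi psi, (forall l, phi l = psi l) -> forall l, H phi l = H psi l;
  ctr_lin : forall a b phi psi l,
    H (fun m => a * phi m + b * psi m) l = a * H phi l + b * H psi l;
  ctr_homotopy : forall phi l, cobd (H phi) l + H (cobd phi) l
    = phi (map f l) - phi (map (fun _ => x0) l);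
  ctr_length : forall phi,
    (forall m m', length m = length m' -> phi m = phi m') ->
    forall l l', length l = length l' -> H phi l = H phi l';
  ctr_vanish : forall phi, vanish E phi -> vanish E' (H phi)
}.

Fixpoint nsum (n : nat) (F : nat -> Z) : Z :=
  match n with O => 0 | S m => nsum m F + F m end.

Lemma nsum_ext (n : nat) (F G : nat -> Z) :
  (forall i, (i < n)%nat -> F i = G i) -> nsum n F = nsum n G.
Proof.
  induction n as [|n IH]; intros H; simpl; [easy|].
  rewrite IH, H; auto.
Qed.

Lemma nsum_lin (n : nat) (a b : Z) (F G : nat -> Z) :
  nsum n (fun i => a * F i + b * G i) = a * nsum n F + b * nsum n G.
Proof. induction n as [|n IH]; simpl; [ring|]. rewrite IH; ring. Qed.

Lemma nsum_zero (n : nat) (F : nat -> Z) :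
  (forall i, (i < n)%nat -> F i = 0) -> nsum n F = 0.
Proof.
  induction n as [|n IH]; intros H; simpl; [easy|].
  rewrite IH, H; auto.
Qed.

Lemma nsum_telescope (n : nat) (F : nat -> Z) :
  nsum n (fun i => F (S i) - F i) = F n - F O.
Proof. induction n as [|n IH]; simpl; [ring|]. rewrite IH; ring. Qed.

Lemma nsum_shift (n : nat) (F : nat -> Z) :
  nsum n (fun i => F (S i)) - nsum n F = F n - F O.
Proof.
  rewrite <- nsum_telescope.
  rewrite (nsum_ext n (fun i => F (S i) - F i) (fun i => 1 * F (S i) + (-1) * F i))
    by (intros; ring).
  rewrite nsum_lin; ring.
Qed.

(** A path of maps cut into [n] steps gives the sum of the prisms of its steps: the endpoint terms
    telescope, and smallness is asked of single steps only. *)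
Lemma contraction_of_steps (f : X -> X) (x0 : X) (E' E : X -> X -> Prop)
  (n : nat) (h : nat -> X -> X) :
  (forall x, h O x = x0) -> (forall x, h n x = f x) ->
  (forall x, E' x x) ->
  (forall i x y, (i < n)%nat -> E' x y ->
     E (h i x) (h i y) /\ E (h i x) (h (S i) y) /\ E (h (S i) x) (h (S i) y)) ->
  contraction f x0 E' E
    (fun phi l => nsum n (fun i => prism (h i) (h (S i)) phi l)).
Proof.
  intros H0 Hn Hr HE. split.
  - intros phi psi H l. apply nsum_ext; intros; now apply prism_ext.
  - intros a b phi psi l. rewrite <- nsum_lin. apply nsum_ext; intros; apply prism_lin.
  - intros phi l.
    rewrite <- (map_ext _ _ Hn), <- (map_ext _ _ H0). clear.
    induction n as [|n IH]; simpl.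
    + rewrite cobd_zero; ring.
    + set (P := fun m => nsum n (fun i => prism (h i) (h (S i)) phi m)) in *.
      rewrite (cobd_ext _ (fun m => 1 * P m + 1 * prism (h n) (h (S n)) phi m))
        by (intros; unfold P; ring).
      rewrite cobd_lin.
      pose proof (prism_homotopy (h n) (h (S n)) phi l). lia.
  - intros phi H l l' E1. apply nsum_ext; intros; now apply prism_length.
  - intros phi H l Hl. apply nsum_zero. intros i Hi.
    apply (prism_vanish E E'); auto.
Qed.

(** * The operators [T - 1] and [1 + T + ... + T^(k-1)] on cochains *)

Definition diff (T : X -> X) (phi : list X -> Z) (l : list X) : Z :=
  phi (map T l) - phi l.

Definition trace (k : nat) (T : X -> X) (phi : list X -> Z) (l : list X) : Z :=
  nsum k (fun i => phi (map (Nat.iter i T) l)).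

Lemma map_iter_S (T : X -> X) (i : nat) (l : list X) :
  map T (map (Nat.iter i T) l) = map (Nat.iter (S i) T) l.
Proof. now rewrite map_map. Qed.

Lemma map_iter_S' (T : X -> X) (i : nat) (l : list X) :
  map (Nat.iter i T) (map T l) = map (Nat.iter (S i) T) l.
Proof.
  rewrite map_map. apply map_ext. intros x. now rewrite Nat.iter_succ_r.
Qed.

Lemma cobd_diff (T : X -> X) (phi : list X -> Z) (l : list X) :
  cobd (diff T phi) l = diff T (cobd phi) l.
Proof.
  unfold diff. now rewrite cobd_sub, (cobd_map T).
Qed.

Lemma cobd_trace (k : nat) (T : X -> X) (phi : list X -> Z) (l : list X) :
  cobd (trace k T phi) l = trace k T (cobd phi) l.
Proof.
  unfold trace. induction k as [|k IH]; cbn [nsum]; [apply cobd_zero|].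
  rewrite <- IH, <- cobd_map.
  rewrite (cobd_ext _ (fun m => 1 * nsum k (fun i => phi (map (Nat.iter i T) m))
     + 1 * phi (map (Nat.iter k T) m))) by (intros; rewrite !Z.mul_1_l; reflexivity).
  rewrite (cobd_lin 1 1 _ (fun m => phi (map (Nat.iter k T) m))). ring.
Qed.

Lemma trace_diff (k : nat) (T : X -> X) (phi : list X -> Z) (l : list X) :
  (forall x, Nat.iter k T x = x) -> trace k T (diff T phi) l = 0.
Proof.
  intros Tk. unfold trace, diff.
  rewrite (nsum_ext k _ (fun i => phi (map (Nat.iter (S i) T) l)
                                  - phi (map (Nat.iter i T) l))).
  - rewrite (nsum_telescope k (fun i => phi (map (Nat.iter i T) l))).
    rewrite (map_ext _ _ Tk). change (map (Nat.iter 0 T) l) with (map (fun x => x) l).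
    ring.
  - intros i _. now rewrite map_iter_S.
Qed.

Lemma diff_trace (k : nat) (T : X -> X) (phi : list X -> Z) (l : list X) :
  (forall x, Nat.iter k T x = x) -> diff T (trace k T phi) l = 0.
Proof.
  intros Tk. unfold trace, diff.
  rewrite (nsum_ext k (fun i => phi (map (Nat.iter i T) (map T l)))
             (fun i => phi (map (Nat.iter (S i) T) l))).
  - rewrite (nsum_shift k (fun i => phi (map (Nat.iter i T) l))).
    rewrite (map_ext _ _ Tk). change (map (Nat.iter 0 T) l) with (map (fun x => x) l).
    ring.
  - intros i _. now rewrite map_iter_S'.
Qed.

(** * Cup products and the carry cocycles *)

Definition cup1 (s : X -> Z) (g : list X -> Z) (l : list X) : Z :=
  match l with x :: _ => s x * g l | _ => 0 end.

(** As in the Alexander-Whitney formula, the vertex shared by the front and the back face stays in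
    the argument of [g]. *)
Definition cup2 (b : X -> X -> Z) (g : list X -> Z) (l : list X) : Z :=
  match l with x :: (y :: _) as l' => b x y * g l' | _ => 0 end.

Definition cup3 (b : X -> X -> X -> Z) (g : list X -> Z) (l : list X) : Z :=
  match l with x :: y :: (z :: _) as l' => b x y z * g l' | _ => 0 end.

(** Leibniz rule; its second term vanishes because [g] is a cocycle. *)
Lemma cobd_cup1 (s : X -> Z) (g : list X -> Z) (l : list X) :
  (forall m, cobd g m = 0) ->
  cobd (cup1 s g) l = cup2 (fun x y => s y - s x) g l.
Proof.
  intros Hg. destruct l as [|x [|y l]]; simpl; try ring.
  specialize (Hg (x :: y :: l)). simpl in Hg.
  pose proof (cobd_scal (s x) (fun m => g (x :: m)) (y :: l)) as E.
  simpl in E. lia.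
Qed.

Lemma cobd_cup2 (b : X -> X -> Z) (g : list X -> Z) (l : list X) :
  (forall m, cobd g m = 0) ->
  cobd (cup2 b g) l = cup3 (fun x y z => b y z - b x z + b x y) g l.
Proof.
  intros Hg. destruct l as [|x [|y [|z l]]]; simpl; try ring.
  specialize (Hg (y :: z :: l)). simpl in Hg.
  pose proof (cobd_scal (b x y) (fun m => g (y :: m)) (z :: l)) as E.
  simpl in E. lia.
Qed.

(** The borrow when [s x] is subtracted from [s y] with digits in [[0, k)]. *)
Definition carry (s : X -> Z) (x y : X) : Z := if s y <? s x then 1 else 0.

(** The coboundary of [carry s]; unlike [carry s] it is [T]-invariant when [s] is
    equivariant. *)
Definition carry_class (s : X -> Z) (x y z : X) : Z :=
  carry s y z - carry s x z + carry s x y.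

(** The cup product of the 2-cocycles [carry_class s], ending in the unit 0-cocycle; it is supported
    on lists of length [2 * length ss + 1]. *)
Fixpoint Gam (ss : list (X -> Z)) : list X -> Z :=
  match ss with
  | [] => fun l => match l with [_] => 1 | _ => 0 end
  | s :: ss' => cup3 (carry_class s) (Gam ss')
  end.

(** [Gam (s :: ss)] is even the coboundary of [cup2 (carry s) (Gam ss)]. *)
Lemma Gam_cocycle (ss : list (X -> Z)) (l : list X) : cobd (Gam ss) l = 0.
Proof.
  revert l; induction ss as [|s ss IH]; intros l.
  - destruct l as [|x [|y [|z l]]]; simpl; try ring.
    pose proof (cobd_zero l). lia.
  - simpl. rewrite (cobd_ext _ (cobd (cup2 (carry s) (Gam ss)))).
    + apply cobd_cobd.
    + intros m. now rewrite cobd_cup2.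
Qed.

Lemma Gam_map (f : X -> X) (ss : list (X -> Z)) (l : list X) :
  Gam ss (map f l) = Gam (map (fun s x => s (f x)) ss) l.
Proof.
  revert l; induction ss as [|s ss IH]; intros l; destruct l as [|x [|y [|z l]]];
    simpl; try easy.
  now rewrite <- IH.
Qed.

(** [s] takes values in [Z/k], represented by [[0, k)], and [T] acts as [-1]. *)
Definition equivariant (k : nat) (T : X -> X) (s : X -> Z) : Prop :=
  forall x, 0 <= s x < Z.of_nat k /\
    s (T x) = if s x =? 0 then Z.of_nat k - 1 else s x - 1.

(** The representative in [[0, k)] of [s y - s x] modulo [k]. *)
Definition residue (k : nat) (s : X -> Z) (x y : X) : Z :=
  s y - s x + Z.of_nat k * carry s x y.

Ltac zcases := repeat match goal with
  | |- context [?a =? ?b] => destruct (Z.eqb_spec a b)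
  | |- context [?a <? ?b] => destruct (Z.ltb_spec a b)
  end.

Lemma residue_invariant (k : nat) (T : X -> X) (s : X -> Z) (x y : X) :
  equivariant k T s -> residue k s (T x) (T y) = residue k s x y.
Proof.
  intros H. destruct (H x) as [Hx Tx], (H y) as [Hy Ty].
  unfold residue, carry. rewrite Tx, Ty. zcases; lia.
Qed.

(** Up to the factor [k], [carry_class s] is the coboundary of the invariant [residue k s]; the case
    analysis checks the claim directly. *)
Lemma carry_class_invariant (k : nat) (T : X -> X) (s : X -> Z) (x y z : X) :
  equivariant k T s -> carry_class s (T x) (T y) (T z) = carry_class s x y z.
Proof.
  intros H.
  destruct (H x) as [Hx Tx], (H y) as [Hy Ty], (H z) as [Hz Tz].
  unfold carry_class, carry. rewrite Tx, Ty, Tz. zcases; lia.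
Qed.

Lemma Gam_invariant (k : nat) (T : X -> X) (ss : list (X -> Z)) (l : list X) :
  Forall (equivariant k T) ss -> Gam ss (map T l) = Gam ss l.
Proof.
  intros H; revert l; induction H as [|s ss Hs _ IH]; intros l;
    destruct l as [|x [|y [|z l]]]; simpl; try easy.
  rewrite (carry_class_invariant k) by easy. f_equal. apply (IH (z :: l)).
Qed.

Lemma invariant_iter {B : Type} (T : X -> X) (g : list X -> B) :
  (forall l, g (map T l) = g l) ->
  forall i l, g (map (Nat.iter i T) l) = g l.
Proof.
  intros H i; induction i as [|i IH]; intros l.
  - simpl. f_equal. apply map_id.
  - rewrite <- map_iter_S, H. apply IH.
Qed.

(** * Sums along orbits, and vanishing of the cup product on small simplices *)

Definition orbit_sum (k : nat) (T : X -> X) (s : X -> Z) (x : X) : Z :=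
  nsum k (fun i => s (Nat.iter i T x)).

(** Along an orbit [s] runs once through [[0, k)]. Instead of computing the sum, both points are
    moved along their orbits to zeros of [s], from where all values of [s] agree. *)
Lemma orbit_sum_const (k : nat) (T : X -> X) (s : X -> Z) (x y : X) :
  (forall z, Nat.iter k T z = z) -> equivariant k T s ->
  orbit_sum k T s x = orbit_sum k T s y.
Proof.
  intros Tk H.
  assert (inv : forall z, orbit_sum k T s (T z) = orbit_sum k T s z).
  { intros z. unfold orbit_sum.
    rewrite (nsum_ext k _ (fun i => s (Nat.iter (S i) T z)))
      by (intros; now rewrite Nat.iter_succ_r).
    pose proof (nsum_shift k (fun i => s (Nat.iter i T z))) as E.
    cbv beta in E. rewrite Tk in E. change (Nat.iter 0 T z) with z in E. lia. }
  (* [T] lowers [s] by one, so a zero is reached after [s z] steps. *)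
  assert (zero : forall n z, s z = Z.of_nat n ->
    exists w, s w = 0 /\ orbit_sum k T s w = orbit_sum k T s z).
  { induction n as [|n IH]; intros z Hz; [now exists z|].
    destruct (H z) as [_ Tz].
    destruct (IH (T z)) as (w & Hw & E).
    - rewrite Tz. destruct (Z.eqb_spec (s z) 0); lia.
    - exists w. split; [easy|]. now rewrite E. }
  destruct (zero (Z.to_nat (s x)) x) as (w & Hw & <-); [pose proof (H x); lia|].
  destruct (zero (Z.to_nat (s y)) y) as (w' & Hw' & <-); [pose proof (H y); lia|].
  apply nsum_ext. intros i _. clear - H Hw Hw'.
  induction i as [|i IH]; simpl; [congruence|].
  destruct (H (Nat.iter i T w)) as [_ ->], (H (Nat.iter i T w')) as [_ ->].
  now rewrite IH.
Qed.

(** Sum [k * carry = residue - (s y - s x)] over the orbit: [residue] is constant there, and the two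
    orbit sums of [s] cancel. *)
Lemma carry_trace (k : nat) (T : X -> X) (s : X -> Z) (x y : X) :
  (0 < k)%nat -> (forall z, Nat.iter k T z = z) -> equivariant k T s ->
  nsum k (fun i => carry s (Nat.iter i T x) (Nat.iter i T y)) = residue k s x y.
Proof.
  intros Hk Tk H.
  assert (R : forall i, residue k s (Nat.iter i T x) (Nat.iter i T y)
                        = residue k s x y).
  { induction i as [|i IH]; simpl; [easy|]. now rewrite residue_invariant. }
  pose proof (orbit_sum_const k T s x y Tk H) as S.
  unfold orbit_sum in S.
  (* Partial sums keep the two sums of [s], which agree only at [n = k]. *)
  assert (E : forall n, Z.of_nat k * nsum n (fun i => carry s (Nat.iter i T x) (Nat.iter i T y))
    = Z.of_nat n * residue k s x y - nsum n (fun i => s (Nat.iter i T y))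
      + nsum n (fun i => s (Nat.iter i T x))).
  { induction n as [|n IH]; [simpl; lia|].
    cbn [nsum]. rewrite Z.mul_add_distr_l, IH. specialize (R n).
    unfold residue in R at 1. lia. }
  specialize (E k). rewrite S in E.
  apply (Z.mul_reg_l _ _ (Z.of_nat k)); lia.
Qed.

(** In a small simplex the first vertex is related to all later ones, so a map [s] constant near it
    is constant on the simplex and makes its factor vanish. *)
Lemma Gam_vanish (E : X -> X -> Prop) (ss : list (X -> Z)) :
  (forall x, exists s, In s ss /\ forall y, E x y -> s y = s x) ->
  vanish E (Gam ss).
Proof.
  intros H l Hl.
  destruct l as [|x l]; [destruct ss; easy|].
  destruct (H x) as (s & Hs & Hx).
  assert (G : Forall (fun y => s y = s x) (x :: l)).
  { inversion Hl as [|? ? H1 H2]; subst. constructor; [easy|].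
    revert H1; apply Forall_impl; auto. }
  (* The common value is frozen as [c], since the induction drops leading vertices. *)
  clear H Hl Hx. revert G. generalize (s x) as c. generalize (x :: l).
  clear x l. induction ss as [|s' ss IH]; intros l c G; [destruct Hs|].
  destruct l as [|x [|y [|z l]]]; simpl; try easy.
  inversion G as [|? ? Gx G1]; subst. inversion G1 as [|? ? Gy G2]; subst.
  destruct Hs as [-> | Hs].
  - inversion G2 as [|? ? Gz G3]; subst.
    unfold carry_class, carry. rewrite Gy, Gz. rewrite Z.ltb_irrefl. ring.
  - rewrite (IH Hs (z :: l) (s x)) by easy. ring.
Qed.

(** * Evaluation on the chains of the lens space model *)

(** [ev] is evaluation on the chain [c_(2n)]; [ev_bd] says that [(T - 1)] kills its
    boundary. *)
Record even_chain (k : nat) (T : X -> X) (n : nat) (E : X -> X -> Prop)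
  (ev : (list X -> Z) -> Z) : Prop := {
  ev_ext : forall phi psi, (forall l, phi l = psi l) -> ev phi = ev psi;
  ev_lin : forall a b phi psi,
    ev (fun l => a * phi l + b * psi l) = a * ev phi + b * ev psi;
  ev_vanish : forall phi, vanish E phi -> ev phi = 0;
  ev_bd : forall phi, ev (cobd (diff T phi)) = 0;
  ev_Gam : forall ss, length ss = n -> Forall (equivariant k T) ss ->
    exists e q, (e = 1 \/ e = -1) /\ ev (Gam ss) = e + Z.of_nat k * q
}.

Lemma even_chain_point (k : nat) (T : X -> X) (E : X -> X -> Prop) (x0 : X) :
  even_chain k T 0 E (fun phi => phi [x0]).
Proof.
  split.
  - auto.
  - auto.
  - intros phi H. apply H. repeat constructor.
  (* The boundary of a vertex is the empty simplex, which [T] fixes. *)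
  - intros phi. simpl. unfold diff. simpl. ring.
  - intros [|? ?] L _; [|discriminate]. exists 1, 0. split; [now left|]. cbn [Gam]. ring.
Qed.

(** Read dually, [T - 1] and then [H1] turn the chain [c_(2n)] into [c_(2n+1)]; the norm of [T] and
    then [H2] turn that into [c_(2n+2)]. *)
Lemma even_chain_step (k : nat) (T f : X -> X) (x0 : X) (n : nat)
  (E2 E1 E : X -> X -> Prop) (H1 H2 : (list X -> Z) -> list X -> Z)
  (ev : (list X -> Z) -> Z) :
  (0 < k)%nat -> (forall x, Nat.iter k T x = x) ->
  (forall x, f (T x) = T (f x)) ->
  (forall x y, E2 x y -> E2 (T x) (T y)) ->
  (forall x y, E1 x y -> E1 (T x) (T y)) ->
  contraction f x0 E2 E1 H1 -> contraction f x0 E1 E H2 ->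
  even_chain k T n E2 ev ->
  even_chain k T (S n) E
    (fun phi => ev (diff T (H1 (trace k T (H2 phi))))).
Proof.
  intros Hk Tk fT TE2 TE1 C1 C2 V.
  (* Evaluation on [c_(2n+1)]. *)
  set (ev1 := fun phi => ev (diff T (H1 phi))).
  assert (ev1_ext : forall phi psi, (forall l, phi l = psi l) -> ev1 phi = ev1 psi).
  { intros phi psi E0. apply (ev_ext _ _ _ _ _ V). intros l. unfold diff.
    now rewrite !(ctr_ext _ _ _ _ _ C1 _ _ E0). }
  assert (ev1_lin : forall a b phi psi,
    ev1 (fun l => a * phi l + b * psi l) = a * ev1 phi + b * ev1 psi).
  { intros a b phi psi. unfold ev1. rewrite <- (ev_lin _ _ _ _ _ V).
    apply (ev_ext _ _ _ _ _ V). intros l. unfold diff.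
    rewrite !(ctr_lin _ _ _ _ _ C1). ring. }
  assert (ev_zero : forall phi, (forall l, phi l = 0) -> ev phi = 0).
  { intros phi Z0. apply (ev_vanish _ _ _ _ _ V). intros l _; apply Z0. }
  (* [H1] of such a cochain again depends on the length alone, hence is killed by [T - 1]. *)
  assert (ev1_length : forall phi,
    (forall m m', length m = length m' -> phi m = phi m') -> ev1 phi = 0).
  { intros phi L. apply ev_zero. intros l. unfold diff.
    rewrite (ctr_length _ _ _ _ _ C1 phi L (map T l) l); [ring|].
    apply length_map. }
  assert (ev1_zero : forall phi, (forall l, phi l = 0) -> ev1 phi = 0).
  { intros phi Z0. apply ev1_length. intros; now rewrite !Z0. }
  assert (constE : forall (m m' : list X), length m = length m' ->
    map (fun _ => x0) m = map (fun _ => x0) m').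
  { intros m m' L. rewrite !map_const. now rewrite L. }
  (* [d c_(2n+1) = (T - 1) f c_(2n)]: in the homotopy formula [ev_bd] removes the coboundary term,
     and the constant end cancels under [T - 1]. *)
  assert (bd1 : forall eta, ev1 (cobd eta) = ev (diff T (fun l => eta (map f l)))).
  { intros eta. unfold ev1.
    rewrite (ev_ext _ _ _ _ _ V _ (fun l => 1 * diff T (fun l => eta (map f l)) l
      + (-1) * cobd (diff T (H1 eta)) l)).
    - rewrite (ev_lin _ _ _ _ _ V), (ev_bd _ _ _ _ _ V). ring.
    - intros l. rewrite cobd_diff. unfold diff.
      pose proof (ctr_homotopy _ _ _ _ _ C1 eta l) as P.
      pose proof (ctr_homotopy _ _ _ _ _ C1 eta (map T l)) as Q.
      rewrite (constE (map T l) l) in Q by apply length_map. lia. }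
  (* The norm of [T] kills this boundary, its product with [T - 1] being zero. *)
  assert (bd1_trace : forall phi, ev1 (cobd (trace k T phi)) = 0).
  { intros phi. rewrite bd1. apply ev_zero. intros l.
    rewrite <- (diff_trace k T phi (map f l) Tk). unfold diff.
    rewrite !map_map. rewrite (map_ext _ _ fT). reflexivity. }
  set (ev2 := fun phi => ev1 (trace k T (H2 phi))).
  (* [d c_(2n+2)] is the norm of [f c_(2n+1)], by the same argument with [bd1_trace] and
     [ev1_length]. *)
  assert (bd2 : forall eta, ev2 (cobd eta) = ev1 (trace k T (fun l => eta (map f l)))).
  { intros eta. unfold ev2.
    rewrite (ev1_ext _ (fun l => 1 * (1 * trace k T (fun l => eta (map f l)) l
      + (-1) * trace k T (fun l => eta (map (fun _ => x0) l)) l)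
      + (-1) * cobd (trace k T (H2 eta)) l)).
    - rewrite !ev1_lin, bd1_trace.
      rewrite (ev1_length (trace k T (fun l => eta (map (fun _ => x0) l)))); [ring|].
      intros m m' L. unfold trace. apply nsum_ext. intros i _. f_equal.
      apply constE. now rewrite !length_map.
    - intros l. rewrite cobd_trace. unfold trace.
      rewrite <- !nsum_lin. apply nsum_ext. intros i _.
      pose proof (ctr_homotopy _ _ _ _ _ C2 eta (map (Nat.iter i T) l)) as P. lia. }
  assert (feq : forall s, equivariant k T s -> equivariant k T (fun x => s (f x))).
  { intros s Hs x. rewrite fT. apply Hs. }
  assert (Ffeq : forall ss, Forall (equivariant k T) ss ->
    Forall (equivariant k T) (map (fun s x => s (f x)) ss)).
  { intros ss Hs. apply Forall_map. revert Hs; apply Forall_impl; auto. }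
  change (even_chain k T (S n) E ev2). split.
  - intros phi psi E0. apply ev1_ext. intros l. apply nsum_ext. intros i _.
    now apply (ctr_ext _ _ _ _ _ C2).
  - intros a b phi psi. unfold ev2. rewrite <- ev1_lin. apply ev1_ext. intros l.
    unfold trace. rewrite <- nsum_lin. apply nsum_ext. intros i _.
    apply (ctr_lin _ _ _ _ _ C2).
  - intros phi Z0. apply (ev_vanish _ _ _ _ _ V).
    assert (Z1 : vanish E2 (H1 (trace k T (H2 phi)))).
    { apply (ctr_vanish _ _ _ _ _ C1). intros l Hl. apply nsum_zero. intros i _.
      apply (ctr_vanish _ _ _ _ _ C2 phi Z0).
      apply small_map with E1; [|easy].
      intros x y Exy. induction i as [|i IH]; simpl; auto. }
    intros l Hl. unfold diff. rewrite !Z1; [ring|easy|].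
    now apply small_map with E2.
  - intros phi. rewrite bd2. apply ev1_zero. intros l.
    rewrite <- (trace_diff k T (fun l => phi (map f l)) l Tk).
    apply nsum_ext. intros i _. unfold diff. rewrite !map_map.
    now rewrite (map_ext _ _ (fun x => fT (Nat.iter i T x))).
  - intros [|s ss] L Hss; [discriminate|]. injection L as L.
    inversion Hss as [|? ? Hs Hss']; subst.
    set (sf := fun x => s (f x)).
    set (g := Gam (map (fun s x => s (f x)) ss)).
    set (sff := fun x => sf (f x)).
    set (ss2 := map (fun s x => s (f x)) (map (fun s x => s (f x)) ss)).
    assert (Hg : forall m, cobd g m = 0) by apply Gam_cocycle.
    assert (gT : forall i m, g (map (Nat.iter i T) m) = g m).
    { apply invariant_iter. intros m. apply (Gam_invariant k); auto. }
    (* [Gam (s :: ss)] is a coboundary, so it can be evaluated on the boundary of [c_(2n+2)]; this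
       composes every map with [f]. *)
    assert (A1 : ev2 (Gam (s :: ss)) = ev1 (trace k T (cup2 (carry sf) g))).
    { transitivity (ev2 (cobd (cup2 (carry s) (Gam ss)))).
      - apply ev1_ext; intros l. apply nsum_ext; intros i _.
        apply (ctr_ext _ _ _ _ _ C2). intros m. symmetry.
        apply cobd_cup2. apply Gam_cocycle.
      - rewrite bd2. apply ev1_ext; intros l. apply nsum_ext; intros i _.
        unfold g. destruct (map (Nat.iter i T) l) as [|x [|y m]]; simpl; try easy.
        f_equal. apply (Gam_map f ss (y :: m)). }
    (* The norm of [carry] is [residue], that is, the coboundary of [sf] modulo [k]. *)
    assert (A2 : ev1 (trace k T (cup2 (carry sf) g))
      = ev1 (cobd (cup1 sf g)) + Z.of_nat k * ev1 (cup2 (carry sf) g)).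
    { rewrite <- (Z.mul_1_l (ev1 (cobd _))), <- ev1_lin.
      apply ev1_ext; intros l. rewrite cobd_cup1 by easy.
      destruct l as [|x [|y l]];
        try (unfold trace; simpl; rewrite nsum_zero by easy; ring).
      transitivity (residue k sf x y * g (y :: l)).
              - rewrite <- (carry_trace k T sf x y Hk Tk (feq s Hs)). unfold trace. simpl.
        clear - gT. induction k as [|k IH]; simpl; [easy|].
        rewrite IH. specialize (gT k (y :: l)). simpl in gT. rewrite gT. ring.
      - unfold residue. cbn [cup2]. ring. }
    (* [T - 1] sends [sff] to [-1] modulo [k]. *)
    assert (A3 : ev1 (cobd (cup1 sf g)) = (-1) * ev (Gam ss2)
      + Z.of_nat k * ev (cup1 (fun x => if sff x =? 0 then 1 else 0) (Gam ss2))).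
    { rewrite bd1, <- (ev_lin _ _ _ _ _ V). apply (ev_ext _ _ _ _ _ V).
      intros l. unfold diff, g. 
      destruct l as [|x l].
      { simpl. unfold ss2. destruct ss; simpl; ring. }
      pose proof (Gam_map f (map (fun s x => s (f x)) ss) (x :: l)) as G1.
      pose proof (Gam_map f (map (fun s x => s (f x)) ss) (map T (x :: l))) as G2.
      fold ss2 in G1, G2.
      rewrite (Gam_invariant k T ss2) in G2 by (unfold ss2; auto).
      cbn [map] in *. cbn [cup1].
      rewrite G1, G2. fold (sff (T x)). fold (sff x).
      destruct (feq _ (feq _ Hs) x) as [R1 R2].
      change (sff (T x) = if sff x =? 0 then Z.of_nat k - 1 else sff x - 1) in R2.
      rewrite R2. destruct (sff x =? 0) eqn:Z0; [apply Z.eqb_eq in Z0; rewrite Z0|]; ring. }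
    destruct (ev_Gam _ _ _ _ _ V ss2) as (e & q & He & Hq).
    { unfold ss2. now rewrite !length_map. }
    { unfold ss2; auto. }
    rewrite A1, A2, A3, Hq.
    (* The factor [-1] from [A3] flips the sign at each step. *)
    exists (- e), (- q + ev (cup1 (fun x => if sff x =? 0 then 1 else 0) (Gam ss2))
      + ev1 (cup2 (carry sf) g)).
    split; [lia|ring].
Qed.

(** On an [E]-small chain of degree [2 * length ss] the cup product is [0] by the covering
    hypothesis, yet [+1] or [-1] modulo [k]. *)
Theorem no_equivariant_contraction (k : nat) (T f : X -> X) (x0 : X)
  (ent : (X -> X -> Prop) -> Prop) (E : X -> X -> Prop) (ss : list (X -> Z)) :
  (2 <= k)%nat -> (forall x, Nat.iter k T x = x) ->
  (forall x, f (T x) = T (f x)) ->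
  (forall E, ent E -> forall x y, E x y -> E (T x) (T y)) ->
  (forall E, ent E -> exists E', ent E' /\ exists H, contraction f x0 E' E H) ->
  ent E -> Forall (equivariant k T) ss ->
  (forall x, exists s, In s ss /\ forall y, E x y -> s y = s x) ->
  False.
Proof.
  intros Hk Tk fT TE HC HE Hss Hcov.
  (* All [E] are treated at once: each step needs the preceding chain to be small for a finer
     entourage. *)
  assert (Ex : forall n E, ent E -> exists ev, even_chain k T n E ev).
  { induction n as [|n IH]; intros E0 HE0.
    - eexists; apply (even_chain_point k T E0 x0).
    - destruct (HC E0 HE0) as (E1 & HE1 & H2 & C2).
      destruct (HC E1 HE1) as (E2 & HE2 & H1 & C1).
      destruct (IH E2 HE2) as (ev & V).
      eexists. apply (even_chain_step k T f x0 n E2 E1 E0 H1 H2 ev); auto;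
      [lia | exact (TE E2 HE2) | exact (TE E1 HE1)]. }
  destruct (Ex (length ss) E HE) as (ev & V).
  destruct (ev_Gam _ _ _ _ _ V ss eq_refl Hss) as (e & q & He & Hq).
  rewrite (ev_vanish _ _ _ _ _ V) in Hq by now apply Gam_vanish.
  assert (D : (Z.of_nat k | 1)).
  { destruct He as [-> | ->]; [exists (-q) | exists q]; lia. }
  apply Z.divide_pos_le in D; lia.
Qed.

End Cochains.

(** * Elementary norm estimates, the Neumann series and characters *)

Section NormedAlgebra.
Context {A : CstarAlg}.
Implicit Types a b c x y : A.

Lemma add0l a : add zero a = a.
Proof. now rewrite addC, add0. Qed.

Lemma add_cancel a b c : add a b = add a c -> b = c.
Proof.
  intros H. rewrite <- (add0l b), <- (add0l c), <- (addN A a), (addC A a).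
  now rewrite <- !addA, H.
Qed.

Lemma opp_unique a b : add a b = zero -> b = opp a.
Proof. intros H. apply (add_cancel a). now rewrite H, addN. Qed.

Lemma scal_C0 a : scal C0 a = zero.
Proof.
  apply (add_cancel (scal C0 a)). rewrite <- scal_addl, add0. f_equal.
  unfold Cadd, C0; simpl. now rewrite Rplus_0_r.
Qed.

Lemma opp_scal a : opp a = scal (mkCx (-1) 0) a.
Proof.
  symmetry; apply opp_unique. rewrite <- (scal1 A a) at 1.
  rewrite <- scal_addl, <- (scal_C0 a). f_equal.
  unfold Cadd, C0, Defs.C1; simpl. f_equal; ring.
Qed.

Lemma opp_add a b : opp (add a b) = add (opp a) (opp b).
Proof. now rewrite !opp_scal, scal_addr. Qed.

Lemma opp_opp a : opp (opp a) = a.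
Proof. symmetry; apply opp_unique. now rewrite addC, addN. Qed.

Lemma mul_opp a b : mul a (opp b) = opp (mul a b).
Proof. now rewrite !opp_scal, mul_scalr. Qed.

Lemma sub_chain a b c : sub a c = add (sub a b) (sub b c).
Proof.
  unfold sub. rewrite <- (addA _ a), (addA _ (opp b)), (addC _ (opp b)), addN.
  now rewrite add0l.
Qed.

Lemma opp_sub a b : opp (sub a b) = sub b a.
Proof. unfold sub. now rewrite opp_add, opp_opp, addC. Qed.

Lemma sub_diag a : sub a a = zero.
Proof. apply addN. Qed.

Lemma sub_zero a : sub a zero = a.
Proof.
  unfold sub. rewrite <- (add0l (opp zero)), addN. apply add0.
Qed.

Lemma sub_eq0 a b : sub a b = zero -> a = b.
Proof.
  intros H. rewrite <- (opp_opp a). symmetry. apply opp_unique.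
  rewrite addC. rewrite <- (opp_opp b), <- opp_add, (addC _ (opp b)).
  fold (sub a b). rewrite H. symmetry; apply opp_unique, add0.
Qed.

Lemma scal_sub z a b : scal z (sub a b) = sub (scal z a) (scal z b).
Proof.
  unfold sub. rewrite scal_addr. f_equal. rewrite !opp_scal, <- !scal_mul. f_equal.
  unfold Cmul; simpl; f_equal; ring.
Qed.

Lemma mul_sub a b c : mul a (sub b c) = sub (mul a b) (mul a c).
Proof. unfold sub. now rewrite mul_addr, mul_opp. Qed.

Lemma sub_add_add a b c d : sub (add a b) (add c d) = add (sub a c) (sub b d).
Proof.
  unfold sub. rewrite opp_add, <- !addA. f_equal.
  rewrite !addA. f_equal. apply addC.
Qed.

Lemma norm_zero : norm (zero : A) = 0.
Proof.
  rewrite <- (scal_C0 zero), norm_scal. unfold Cabs, C0; simpl.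
  replace (0 * 0 + 0 * 0) with 0 by ring. rewrite sqrt_0. ring.
Qed.

Lemma norm_opp a : norm (opp a) = norm a.
Proof.
  rewrite opp_scal, norm_scal. unfold Cabs; simpl.
  replace (-1 * -1 + 0 * 0) with 1 by ring. rewrite sqrt_1. ring.
Qed.

Lemma norm_ge0 a : 0 <= norm a.
Proof.
  pose proof (norm_triangle A a (opp a)) as H.
  rewrite addN, norm_zero, norm_opp in H. lra.
Qed.

Lemma norm_sub_trans a b c : norm (sub a c) <= norm (sub a b) + norm (sub b c).
Proof. rewrite (sub_chain a b c). apply norm_triangle. Qed.

Lemma norm_sub_sym a b : norm (sub a b) = norm (sub b a).
Proof. now rewrite <- opp_sub, norm_opp. Qed.

Lemma norm_sub_diag a : norm (sub a a) = 0.
Proof. rewrite sub_diag. apply norm_zero. Qed.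

Lemma star_one : star (one : A) = one.
Proof.
  pose proof (star_mul A (star one) one) as H.
  rewrite star_star, !mul1r in H. now rewrite star_star in H.
Qed.

Lemma norm_one : norm (one : A) = 1.
Proof.
  pose proof (norm_cstar A one) as H. rewrite star_one, mul1l in H.
  assert (norm (one : A) <> 0) by (intros H0; apply (one_neq0 A), norm_eq0, H0).
  apply (Rmult_eq_reg_l (norm (one : A))); lra.
Qed.

Lemma norm_scal_one z : norm (scal z (one : A)) = Cabs z.
Proof. rewrite norm_scal, norm_one. ring. Qed.

Lemma Cabs_ge0 z : 0 <= Cabs z.
Proof. apply sqrt_pos. Qed.

(** [u n] is [1 + b + ... + b^(n-1)] in Horner form, so each induction step pulls one factor [b] out
    of the difference. *)
Lemma geometric_bound b n p :
  let u := fun n => Nat.iter n (fun s => add one (mul b s)) zero in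
  norm b < 1 ->
  norm (sub (u (n + p)%nat) (u n)) <= norm b ^ n * (1 / (1 - norm b)).
Proof.
  intros u Hb. pose proof (norm_ge0 b) as Hb0.
  induction n as [|n IH].
  - change (u 0%nat) with (zero : A). rewrite sub_zero. simpl. rewrite Rmult_1_l.
    induction p as [|p IH].
    + change (u 0%nat) with (zero : A). rewrite norm_zero.
      apply Rlt_le, Rdiv_lt_0_compat; lra.
    + change (u (S p)) with (add one (mul b (u p))).
      eapply Rle_trans; [apply norm_triangle|]. rewrite norm_one.
      replace (1 / (1 - norm b)) with (1 + norm b * (1 / (1 - norm b)))
        by (field; lra).
      apply Rplus_le_compat_l. eapply Rle_trans; [apply norm_mul|].
      now apply Rmult_le_compat_l.
  - change (u (S n + p)%nat) with (add one (mul b (u (n + p)%nat))).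
    change (u (S n)) with (add one (mul b (u n))).
    rewrite sub_add_add, sub_diag, add0l, <- mul_sub.
    eapply Rle_trans; [apply norm_mul|].
    simpl. rewrite Rmult_assoc. now apply Rmult_le_compat_l.
Qed.

(** The limit of the geometric partial sums; the equation says that [s] is a right inverse of
    [1 - b]. *)
Lemma neumann_series b : norm b < 1 -> exists s, s = add one (mul b s).
Proof.
  intros Hb. pose proof (norm_ge0 b) as Hb0.
  set (u := fun n => Nat.iter n (fun s => add one (mul b s)) zero).
  assert (HK : 0 < 1 / (1 - norm b)) by (apply Rdiv_lt_0_compat; lra).
  destruct (complete A u) as (s & Hs).
  - intros eps Heps.
    destruct (pow_lt_1_zero (norm b)) with (y := eps / 2 / (1 / (1 - norm b)))
      as (N & HN).
    + rewrite Rabs_pos_eq; lra.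
    + apply Rdiv_lt_0_compat; lra.
    + exists N.
      assert (G : forall m, (N <= m)%nat -> norm (sub (u m) (u N)) < eps / 2).
      { intros m Hm. replace m with (N + (m - N))%nat by lia.
        eapply Rle_lt_trans; [now apply geometric_bound|].
        specialize (HN N (le_n N)).
        rewrite Rabs_pos_eq in HN by now apply pow_le.
        apply (Rmult_lt_compat_r _ _ _ HK) in HN.
        replace (eps / 2 / (1 / (1 - norm b)) * (1 / (1 - norm b))) with (eps / 2)
          in HN by (field; lra).
        exact HN. }
      intros m n Hm Hn. apply G in Hm, Hn. rewrite norm_sub_sym in Hn.
      fold (sub (u m) (u n)). pose proof (norm_sub_trans (u m) (u N) (u n)). lra.
  - exists s. apply sub_eq0, norm_eq0.
    apply Rle_antisym; [|apply norm_ge0]. apply le_epsilon. intros eps Heps.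
    destruct (Hs (eps / 2)) as (N & HN); [lra|].
    pose proof (HN N (le_n N)) as H1.
    pose proof (HN (S N) (le_S _ _ (le_n N))) as H2.
    fold (sub (u N) s) in H1. fold (sub (u (S N)) s) in H2.
    pose proof (norm_sub_trans s (u (S N)) (add one (mul b s))) as H3.
    rewrite (norm_sub_sym s (u (S N))) in H3.
    change (u (S N)) with (add one (mul b (u N))) in H3 at 2.
    rewrite sub_add_add, sub_diag, add0l, <- mul_sub in H3.
    pose proof (norm_mul A b (sub (u N) s)) as H4.
    pose proof (norm_ge0 (sub (u N) s)). nra.
Qed.

Lemma hom_zero (f : A -> A) : unital_star_hom f -> f zero = zero.
Proof. intros (_ & Hs & _). specialize (Hs C0 zero). now rewrite !scal_C0 in Hs. Qed.

Lemma hom_sub (f : A -> A) a b : unital_star_hom f -> f (sub a b) = sub (f a) (f b).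
Proof.
  intros (Ha & Hs & _). unfold sub. now rewrite Ha, !opp_scal, Hs.
Qed.

Lemma hom_comp (f g : A -> A) :
  unital_star_hom f -> unital_star_hom g -> unital_star_hom (fun a => f (g a)).
Proof.
  intros (F1 & F2 & F3 & F4 & F5) (G1 & G2 & G3 & G4 & G5).
  repeat split; intros.
  - now rewrite G1, F1.
  - now rewrite G2, F2.
  - now rewrite G3, F3.
  - now rewrite G4, F4.
  - now rewrite G5, F5.
Qed.

(** A character is encoded as an endomorphism with scalar values, so [phi 0] is one, and distances
    of values are norms in [A]. *)
Definition character (f : A -> A) : Prop :=
  unital_star_hom f /\ forall a, exists z, f a = scal z one.

Lemma character_comp (f g : A -> A) :
  character f -> unital_star_hom g -> character (fun a => f (g a)).
Proof. intros [Hf Hz] Hg. split; [now apply hom_comp|auto]. Qed.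

(* If |f a| > |a|, rescale to f b = 1 with |b| < 1; then 1 - b is invertible
   but is killed by f. *)
Lemma character_contractive (f : A -> A) a : character f -> norm (f a) <= norm a.
Proof.
  intros [Hf Hz]. destruct (Hz a) as (z & Ha).
  rewrite Ha, norm_scal_one.
  destruct (Rle_or_lt (Cabs z) (norm a)) as [H|H]; [easy|exfalso].
  pose proof (norm_ge0 a) as Hn.
  set (q := Cre z * Cre z + Cim z * Cim z).
  assert (Hq : 0 < q).
  { destruct (Rle_or_lt q 0) as [H0|]; [|easy].
    unfold Cabs in H. fold q in H. rewrite sqrt_neg_0 in H; lra. }
  set (w := mkCx (Cre z / q) (- Cim z / q)).
  assert (Hw : Cmul w z = Defs.C1).
  { unfold Cmul, w, Defs.C1; simpl. f_equal; [|field; lra].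
    unfold q; field. fold q; lra. }
  set (b := scal w a).
  assert (Hfb : f b = one).
  { unfold b. destruct Hf as (_ & Hs & _). now rewrite Hs, Ha, <- scal_mul, Hw, scal1. }
  assert (Hwz : Cabs w * Cabs z = 1).
  { rewrite <- norm_one, <- (scal1 A one), <- Hw, scal_mul, norm_scal, norm_scal_one.
    reflexivity. }
  assert (Hb : norm b < 1).
  { unfold b. rewrite norm_scal, <- Hwz. apply Rmult_lt_compat_l; [|easy].
    pose proof (Cabs_ge0 w). destruct (Rle_lt_or_eq_dec _ _ H0) as [|E]; [easy|].
    rewrite <- E in Hwz. lra. }
  destruct (neumann_series b Hb) as (s & Hs).
  apply (f_equal f) in Hs.
  destruct Hf as (Hadd & _ & Hmul & _ & Hone).
  rewrite Hadd, Hmul, Hfb, Hone, mul1l in Hs.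
  apply (one_neq0 A), (add_cancel (f s)).
  now rewrite addC, <- Hs, add0.
Qed.

Lemma character_dist (f : A -> A) a b :
  character f -> norm (sub (f a) (f b)) <= norm (sub a b).
Proof.
  intros Hf. rewrite <- hom_sub by apply Hf. now apply character_contractive.
Qed.

Lemma norm_sub_scal_one_lt z w e :
  Rabs (Cre z - Cre w) < e -> Rabs (Cim z - Cim w) < e ->
  norm (sub (scal z (one : A)) (scal w one)) < 2 * e.
Proof.
  intros H1 H2. unfold sub. rewrite opp_scal, <- scal_mul, <- scal_addl, norm_scal_one.
  unfold Cabs, Cadd, Cmul; simpl.
  assert (He : 0 < e) by (pose proof (Rabs_pos (Cre z - Cre w)); lra).
  rewrite <- (sqrt_square (2 * e)) by lra.
  apply Rabs_def2 in H1, H2. apply sqrt_lt_1_alt.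
  set (p := Cre z + _). set (q := Cim z + _).
  assert (Hp : - e < p < e) by (unfold p; lra).
  assert (Hq : - e < q < e) by (unfold q; lra).
  clearbody p q. clear H1 H2. split; nra.
Qed.

Lemma Cre_le z : Rabs (Cre z) <= Cabs z.
Proof.
  rewrite <- sqrt_Rsqr_abs. apply sqrt_le_1_alt. unfold Rsqr. nra.
Qed.

Lemma Cim_le z : Rabs (Cim z) <= Cabs z.
Proof.
  rewrite <- sqrt_Rsqr_abs. apply sqrt_le_1_alt. unfold Rsqr. nra.
Qed.

End NormedAlgebra.

(** * Total boundedness, the form in which compactness of the character space enters *)

Section TotallyBounded.

Definition covered {X : Type} (E : X -> X -> Prop) : Prop :=
  exists Qs : list (X -> Prop),
    (forall x, exists Q, In Q Qs /\ Q x) /\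
    (forall Q, In Q Qs -> forall x y, Q x -> Q y -> E x y).

Lemma covered_weaken {X : Type} (E F : X -> X -> Prop) :
  (forall x y, E x y -> F x y) -> covered E -> covered F.
Proof. intros H (Qs & C & D). exists Qs; split; [easy|]. intros; eauto. Qed.

Lemma covered_and {X : Type} (E F : X -> X -> Prop) :
  covered E -> covered F -> covered (fun x y => E x y /\ F x y).
Proof.
  intros (Qs & C & D) (Qs' & C' & D').
  exists (flat_map (fun Q => map (fun Q' x => Q x /\ Q' x) Qs') Qs). split.
  - intros x. destruct (C x) as (Q & HQ & Qx), (C' x) as (Q' & HQ' & Qx').
    exists (fun x => Q x /\ Q' x). split; [|easy].
    apply in_flat_map. exists Q; split; [easy|].
    now apply (in_map (fun Q' x => Q x /\ Q' x)).
  - intros P HP. apply in_flat_map in HP. destruct HP as (Q & HQ & HP).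
    apply in_map_iff in HP. destruct HP as (Q' & <- & HQ').
    intros x y [] []; eauto.
Qed.

Lemma covered_real {X : Type} (v : X -> R) (B e : R) :
  (forall x, Rabs (v x) <= B) -> 0 < e ->
  covered (fun x y => Rabs (v x - v y) < e).
Proof.
  intros HB He.
  (* The cover is by preimages of [n] consecutive half-open intervals of length [e] starting at
     [- B]. *)
  assert (G : forall n, exists Qs : list (X -> Prop),
    (forall x, v x < - B + INR n * e -> exists Q, In Q Qs /\ Q x) /\
    (forall Q, In Q Qs -> forall x y, Q x -> Q y -> Rabs (v x - v y) < e)).
  { induction n as [|n (Qs & C & D)].
    - exists []. split; [|easy]. intros x Hx. simpl in Hx.
      specialize (HB x). pose proof (Rle_abs (- v x)). rewrite Rabs_Ropp in H. lra.
    - exists ((fun x => - B + INR n * e <= v x < - B + INR (S n) * e) :: Qs). split.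
      + intros x Hx. destruct (Rlt_or_le (v x) (- B + INR n * e)) as [H|H].
        * destruct (C x H) as (Q & HQ & Qx). exists Q; simpl; auto.
        * eexists; split; [left; reflexivity|]. now split.
      + intros Q [<- | HQ]; [|eauto].
        intros x y Hx Hy. rewrite S_INR in *. apply Rabs_def1; lra. }
  destruct (INR_archimed e (2 * B + 1) He) as (n & Hn).
  destruct (G n) as (Qs & C & D). exists Qs; split; [|easy].
  intros x. apply C. specialize (HB x). pose proof (Rle_abs (v x)). lra.
Qed.

End TotallyBounded.

(** * Equivariant maps to [Z/k] from separated sets *)

Section Coloring.
Context {X : Type} (k : nat) (T : X -> X).
Hypothesis k_pos : (0 < k)%nat.
Hypothesis T_period : forall x, Nat.iter k T x = x.

Lemma iter_mod (i : nat) (x : X) : Nat.iter i T x = Nat.iter (i mod k) T x.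
Proof.
  assert (G : forall q r, Nat.iter (r + k * q) T x = Nat.iter r T x).
  { intros q r. rewrite Nat.iter_add. f_equal.
    induction q as [|q IH]; [now rewrite Nat.mul_0_r|].
    now rewrite Nat.mul_succ_r, Nat.iter_add, T_period. }
  rewrite <- (G (i / k) (i mod k))%nat, Nat.add_comm, <- Nat.div_mod_eq. reflexivity.
Qed.

(** Each orbit is represented by its points in the first member of [Ws] it meets. *)
Fixpoint fundamental_domain (Ws : list (X -> Prop)) (x : X) : Prop :=
  match Ws with
  | [] => False
  | W :: Ws' => W x \/ (forall i, ~ W (Nat.iter i T x)) /\ fundamental_domain Ws' x
  end.

Definition separated (W : X -> Prop) : Prop :=
  forall x i, (0 < i < k)%nat -> W x -> ~ W (Nat.iter i T x).

Lemma fundamental_domain_separated (Ws : list (X -> Prop)) :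
  Forall separated Ws -> separated (fundamental_domain Ws).
Proof.
  induction 1 as [|W Ws HW _ IH]; intros x i Hi; simpl; [easy|].
  intros [H|[H H']] [G|[G G']].
  - now apply (HW x i).
  - apply (G (k - i)%nat). rewrite <- Nat.iter_add.
    replace (k - i + i)%nat with k by lia. now rewrite T_period.
  - now apply (H i).
  - now apply (IH x i).
Qed.

Lemma fundamental_domain_meets (Ws : list (X -> Prop)) (x : X) :
  (exists W, In W Ws /\ exists i, W (Nat.iter i T x)) ->
  exists i, (i < k)%nat /\ fundamental_domain Ws (Nat.iter i T x).
Proof.
  induction Ws as [|W Ws IH]; [now intros (? & [] & _)|].
  intros (W' & HW' & i & Hi).
  destruct (excluded_middle_informative (exists j, W (Nat.iter j T x))) as [(j & Hj)|N].
  - exists (j mod k)%nat. split; [apply Nat.mod_upper_bound; lia|].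
    left. now rewrite <- iter_mod.
  - destruct IH as (j & Hj & Dj).
    + destruct HW' as [<- | HW']; [destruct N; eauto|eauto].
    + exists j. split; [easy|]. right. split; [|easy].
      intros m Hm. apply N. exists (m + j)%nat. now rewrite Nat.iter_add.
Qed.

(** [s x] is the number of applications of [T] carrying [x] into the transversal [D]; [T] lowers it
    by one, and from a point of [D] it jumps to [k - 1]. *)
Lemma coloring_exists (D : X -> Prop) :
  separated D -> (forall x, exists i, (i < k)%nat /\ D (Nat.iter i T x)) ->
  exists s, equivariant k T s /\ forall x, D x -> s x = 0%Z.
Proof.
  intros HD HE.
  assert (U : forall x i j, (i < k)%nat -> (j < k)%nat ->
    D (Nat.iter i T x) -> D (Nat.iter j T x) -> i = j).
  { assert (L : forall x i j, (i < j < k)%nat ->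
      D (Nat.iter i T x) -> D (Nat.iter j T x) -> False).
    { intros x i j Hij Di Dj. apply (HD (Nat.iter i T x) (j - i)%nat); [lia|easy|].
      rewrite <- Nat.iter_add. now replace (j - i + i)%nat with j by lia. }
    intros x i j Hi Hj Di Dj. destruct (Nat.lt_trichotomy i j) as [H|[H|H]]; [|easy|].
    - destruct (L x i j); auto with zarith.
    - destruct (L x j i); auto with zarith. }
  set (r := fun x => proj1_sig (constructive_indefinite_description _ (HE x))).
  assert (Hr : forall x, (r x < k)%nat /\ D (Nat.iter (r x) T x)).
  { intros x. unfold r. now destruct constructive_indefinite_description. }
  exists (fun x => Z.of_nat (r x)). split.
  - intros x. destruct (Hr x) as [H D1], (Hr (T x)) as [H' D2]. split; [lia|].
    destruct (r x) as [|i] eqn:Ei.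
    + assert (E : r (T x) = (k - 1)%nat).
      { apply (U (T x)); [easy|lia|easy|]. rewrite <- Nat.iter_succ_r.
        replace (S (k - 1)) with k by lia. now rewrite T_period. }
      rewrite E. simpl. lia.
    + assert (E : r (T x) = i).
      { apply (U (T x)); [easy|lia|easy|]. now rewrite <- Nat.iter_succ_r. }
      rewrite E. destruct (Z.eqb_spec (Z.of_nat (S i)) 0); lia.
  - intros x Dx. destruct (Hr x) as [H D1].
    now rewrite (U x (r x) 0%nat).
Qed.

Lemma locally_constant_colorings (E : X -> X -> Prop) :
  covered E -> (forall x, E x x) ->
  (forall x x' y i, (0 < i < k)%nat ->
     E x x' -> E x y -> E x' (Nat.iter i T y) -> False) ->
  exists ss, Forall (equivariant k T) ss /\
    forall x, exists s, In s ss /\ forall y, E x y -> s y = s x.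
Proof.
  intros (Qs & C & D) Er Hsep.
  set (near := fun (Q : X -> Prop) y => exists x, Q x /\ E x y).
  assert (Hnear : forall Q, In Q Qs -> separated (near Q)).
  { intros Q HQ y i Hi (x & Qx & Exy) (x' & Qx' & Exy').
    apply (Hsep x x' y i); eauto. }
  assert (G : forall Q, In Q Qs ->
    exists s, equivariant k T s /\ forall x, near Q x -> s x = 0%Z).
  { intros Q HQ.
    (* [near Q] is listed first, so it lies wholly in the domain and gets color [0]; the other sets
       make the domain meet every orbit. *)
    destruct (coloring_exists (fundamental_domain (near Q :: map near Qs)))
      as (s & Hs & H0).
    - apply fundamental_domain_separated. constructor; [now apply Hnear|].
      apply Forall_map, Forall_forall. exact Hnear.
    - intros x. apply fundamental_domain_meets.
      destruct (C x) as (Q' & HQ' & Qx). exists (near Q'). split.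
      + right. now apply in_map.
      + exists 0%nat, x. split; [easy|apply Er].
    - exists s. split; [easy|]. intros x Hx. apply H0. now left. }
  assert (L : forall Ps, incl Ps Qs -> exists ss, Forall (equivariant k T) ss /\
    forall Q, In Q Ps -> exists s, In s ss /\ forall x, near Q x -> s x = 0%Z).
  { induction Ps as [|P Ps IH]; intros HP.
    - exists []. split; [constructor|easy].
    - destruct IH as (ss & Hss & Hin); [intros Q HQ; apply HP; now right|].
      destruct (G P) as (s & Hs & H0); [apply HP; now left|].
      exists (s :: ss). split; [now constructor|].
      intros Q [<- | HQ]; [exists s; simpl; auto|].
      destruct (Hin Q HQ) as (s' & Hs' & H'). exists s'; simpl; auto. }
  destruct (L Qs (incl_refl _)) as (ss & Hss & Hin).
  exists ss. split; [easy|]. intros x.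
  destruct (C x) as (Q & HQ & Qx). destruct (Hin Q HQ) as (s & Hs & H0).
  exists s. split; [easy|]. intros y Exy.
  rewrite (H0 x), (H0 y); [easy| |]; exists x; auto.
Qed.

End Coloring.

(** * The character space, its rotation and its contraction *)

Section Characters.
Context {A : CstarAlg}.

(** Compactness of [[0,1]] by a supremum argument: the set of endpoints reachable by finitely many
    close steps can be extended past its supremum unless that is [1]. *)
Lemma path_chain (phi : R -> A -> A) (L : list A) (e : R) :
  0 < e ->
  (forall a t, 0 <= t <= 1 -> forall eps, 0 < eps ->
     exists delta, 0 < delta /\
       forall s, 0 <= s <= 1 -> Rabs (s - t) < delta ->
         norm (sub (phi s a) (phi t a)) < eps) ->
  exists n (t : nat -> R), (forall i, 0 <= t i <= 1) /\ t 0%nat = 0 /\ t n = 1 /\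
    forall i a, (i < n)%nat -> In a L ->
      norm (sub (phi (t i) a) (phi (t (S i)) a)) < e.
Proof.
  intros He Hc.
  set (close := fun s t => forall a, In a L -> norm (sub (phi s a) (phi t a)) < e).
  assert (loc : forall t, 0 <= t <= 1 -> exists d, 0 < d /\
    forall s, 0 <= s <= 1 -> Rabs (s - t) < d -> close s t).
  { intros t Ht. unfold close. clear close. induction L as [|a L IH].
    - exists 1. split; [lra|easy].
    - destruct IH as (d & Hd & H). destruct (Hc a t Ht e He) as (d' & Hd' & H').
      exists (Rmin d d'). split; [now apply Rmin_pos|].
      intros s Hs Hst b [<- | Hb].
      + apply H'; [easy|]. eapply Rlt_le_trans; [exact Hst|apply Rmin_r].
      + apply H; try easy. eapply Rlt_le_trans; [exact Hst|apply Rmin_l]. }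
  set (reach := fun r => exists n (t : nat -> R), (forall i, 0 <= t i <= 1) /\
    t 0%nat = 0 /\ t n = r /\
    forall i, (i < n)%nat -> close (t i) (t (S i))).
  assert (ext : forall r r', reach r -> 0 <= r' <= 1 -> close r r' -> reach r').
  { intros r r' (n & t & H1 & H2 & H3 & H4) Hr' Hrr.
    exists (S n), (fun i => if (i <=? n)%nat then t i else r').
    repeat split.
    - destruct (i <=? n)%nat; [apply H1|easy].
    - destruct (i <=? n)%nat; [apply H1|easy].
    - easy.
    - destruct (Nat.leb_spec (S n) n); [lia|easy].
    - intros i Hi. destruct (Nat.leb_spec i n); [|lia].
      destruct (Nat.leb_spec (S i) n); [apply H4; lia|].
      replace i with n by lia. now rewrite H3. }
  assert (r0 : reach 0).
  { exists 0%nat, (fun _ => 0). repeat split; try lra. intros i Hi; lia. }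
  set (P := fun r => 0 <= r <= 1 /\ reach r).
  destruct (completeness P) as (m & Hub & Hlub).
  - exists 1. intros r [Hr _]. lra.
  - exists 0. split; [lra|easy].
  - assert (Hm : 0 <= m <= 1).
    { split; [apply Hub; split; [lra|easy]|]. apply Hlub. intros r [Hr _]; lra. }
    destruct (loc m Hm) as (d & Hd & Hl).
    assert (Ex : exists r, P r /\ m - d < r).
    { destruct (classic (exists r, P r /\ m - d < r)) as [|N]; [easy|].
      assert (m <= m - d); [|lra].
      apply Hlub. intros r Hr. destruct (Rle_or_lt r (m - d)) as [|H]; [easy|].
      destruct N; eauto. }
    destruct Ex as (r & [Hr Rr] & Hrd).
    assert (r <= m) by (apply Hub; now split).
    assert (Rm : reach m).
    { apply (ext r m); auto. apply Hl; auto. apply Rabs_def1; lra. }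
    set (m' := Rmin 1 (m + d / 2)).
    assert (Hm' : m <= m' <= 1 /\ m' <= m + d / 2).
    { unfold m', Rmin. destruct Rle_dec; lra. }
    assert (Rm' : reach m').
    { apply (ext m m'); [easy|lra|]. intros a Ha. rewrite norm_sub_sym.
      apply Hl; [lra| |easy]. apply Rabs_def1; lra. }
    assert (m' <= m) by (apply Hub; split; [lra|easy]).
    assert (E1 : m' = 1).
    { revert H0. unfold m', Rmin. destruct Rle_dec; lra. }
    rewrite E1 in Rm'. destruct Rm' as (n & t & H1 & H2 & H3 & H4).
    exists n, t. repeat split; try easy; try apply H1.
    intros i a Hi Ha. now apply H4.
Qed.

Definition char_space : Type := {f : A -> A | character f}.

Lemma char_ext (x y : char_space) :
  (forall a, proj1_sig x a = proj1_sig y a) -> x = y.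
Proof.
  destruct x as [f Hf], y as [g Hg]; simpl. intros H.
  assert (E : f = g) by now apply functional_extensionality.
  subst g. f_equal. apply proof_irrelevance.
Qed.

Definition pullback (g : A -> A) (Hg : unital_star_hom g) (x : char_space) : char_space :=
  exist _ (fun a => proj1_sig x (g a)) (character_comp _ g (proj2_sig x) Hg).

(** A basic entourage of the weak-* uniformity. *)
Definition near (L : list A) (e : R) (x y : char_space) : Prop :=
  forall a, In a L -> norm (sub (proj1_sig x a) (proj1_sig y a)) < e.

Lemma near_refl L e x : 0 < e -> near L e x x.
Proof. intros He a _. now rewrite norm_sub_diag. Qed.

(** Characters are contractive, so their values on the finite list [L] stay in a bounded region of a
    finite-dimensional space. *)
Lemma near_covered (L : list A) (e : R) : 0 < e -> covered (near L e).
Proof.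
  intros He. induction L as [|a L IH].
  - exists [fun _ => True]. split.
    + intros x. exists (fun _ => True). simpl; auto.
    + intros Q _ x y _ _ a [].
  - set (z := fun x : char_space => proj1_sig
      (constructive_indefinite_description _ (proj2 (proj2_sig x) a))).
    assert (Hz : forall x, proj1_sig x a = scal (z x) one).
    { intros x. unfold z. now destruct constructive_indefinite_description. }
    assert (Bz : forall x, Cabs (z x) <= norm a).
    { intros x. rewrite <- (norm_scal_one (A := A)), <- Hz. apply character_contractive, proj2_sig. }
    assert (He2 : 0 < e / 2) by lra.
    apply covered_weaken with (E := fun x y =>
      (Rabs (Cre (z x) - Cre (z y)) < e / 2 /\ Rabs (Cim (z x) - Cim (z y)) < e / 2)
      /\ near L e x y).
    + intros x y [[H1 H2] H3] b [<- | Hb]; [|now apply H3].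
      rewrite !Hz. replace e with (2 * (e / 2)) by field. now apply norm_sub_scal_one_lt.
    + apply covered_and; [apply covered_and|easy].
      * apply covered_real with (norm a); [|easy].
        intros x. eapply Rle_trans; [apply Cre_le|apply Bz].
      * apply covered_real with (norm a); [|easy].
        intros x. eapply Rle_trans; [apply Cim_le|apply Bz].
Qed.

Context (k : nat) (alpha : A -> A).
Hypothesis k_ge2 : (2 <= k)%nat.
Hypothesis alpha_hom : unital_star_hom alpha.
Hypothesis alpha_period : forall a, act alpha k a = a.

Definition rotate : char_space -> char_space := pullback alpha alpha_hom.

Lemma rotate_iter (i : nat) (x : char_space) (a : A) :
  proj1_sig (Nat.iter i rotate x) a = proj1_sig x (act alpha i a).
Proof.
  revert a; induction i as [|i IH]; intros a; [easy|].
  change (proj1_sig (Nat.iter i rotate x) (alpha a) = proj1_sig x (act alpha (S i) a)).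
  rewrite IH. unfold act. now rewrite Nat.iter_succ_r.
Qed.

Lemma rotate_period (x : char_space) : Nat.iter k rotate x = x.
Proof. apply char_ext. intros a. now rewrite rotate_iter, alpha_period. Qed.

(** Adding the [alpha]-orbits makes [near (saturate L) e] invariant under rotation. *)
Definition saturate (L : list A) : list A :=
  flat_map (fun a => map (fun i => act alpha i a) (seq 0 k)) L.

Lemma in_saturate (L : list A) (a : A) (i : nat) :
  (i < k)%nat -> In a L -> In (act alpha i a) (saturate L).
Proof.
  intros Hi Ha. apply in_flat_map. exists a. split; [easy|].
  apply (in_map (fun i => act alpha i a)), in_seq. lia.
Qed.

Lemma saturate_incl (L : list A) (a : A) : In a L -> In a (saturate L).
Proof. apply (in_saturate L a 0). lia. Qed.

Lemma saturate_stable (L : list A) (a : A) :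
  In a (saturate L) -> In (alpha a) (saturate L).
Proof.
  intros H. apply in_flat_map in H. destruct H as (b & Hb & H).
  apply in_map_iff in H. destruct H as (i & <- & Hi). apply in_seq in Hi.
  destruct (Nat.eq_dec (S i) k) as [E|N].
  - change (alpha (act alpha i b)) with (act alpha (S i) b).
    rewrite E, alpha_period. now apply saturate_incl.
  - apply (in_saturate L b (S i)); [lia|easy].
Qed.

Definition entourage (E : char_space -> char_space -> Prop) : Prop :=
  exists L e, 0 < e /\ (forall a, In a L -> In (alpha a) L) /\ E = near L e.

Lemma entourage_contraction (phi1 : A -> A) (hphi1 : unital_star_hom phi1)
  (phi : R -> A -> A) (x0 : char_space) (E : char_space -> char_space -> Prop) :
  (forall t, 0 <= t <= 1 -> unital_star_hom (phi t)) ->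
  (forall a t, 0 <= t <= 1 -> forall eps, 0 < eps ->
     exists delta, 0 < delta /\
       forall s, 0 <= s <= 1 -> Rabs (s - t) < delta ->
         norm (sub (phi s a) (phi t a)) < eps) ->
  (forall a, phi 1 a = phi1 a) ->
  (forall a, phi 0 a = proj1_sig x0 a) ->
  entourage E ->
  exists E', entourage E' /\
    exists H, contraction (pullback phi1 hphi1) x0 E' E H.
Proof.
  intros Hphi Hc H1 H0 (L & e & He & HS & ->).
  assert (He2 : 0 < e / 2) by lra.
  destruct (path_chain phi L (e / 2) He2 Hc) as (n & t & Ht & t0 & tn & Hstep).
  (* Closeness of [x] and [y] after pulling back by [phi (t i)] is closeness on the images of [L].
     Half of [e] serves the change of character, half the change of time. *)
  set (L' := saturate (flat_map (fun i => map (phi (t i)) L) (seq 0 (S n)))).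
  exists (near L' (e / 2)). split.
  - exists L', (e / 2). repeat split; [easy|]. apply saturate_stable.
  - set (h := fun i => pullback (phi (t i)) (Hphi (t i) (Ht i))).
    eexists. apply (contraction_of_steps _ _ _ _ n h).
    (* [phi 0] has scalar values, which every unital [x] fixes, so all pullbacks along it are
       [x0]. *)
    + intros x. apply char_ext. intros a. simpl. rewrite t0, H0.
      destruct (proj2 (proj2_sig x0) a) as (z & ->).
      destruct (proj1 (proj2_sig x)) as (_ & Hs & _ & _ & Ho).
      now rewrite Hs, Ho.
    + intros x. apply char_ext. intros a. simpl. now rewrite tn, H1.
    + intros x. now apply near_refl.
    + intros i x y Hi Hxy.
      assert (G : forall j a, (j <= n)%nat -> In a L ->
        norm (sub (proj1_sig x (phi (t j) a)) (proj1_sig y (phi (t j) a))) < e / 2).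
      { intros j a Hj Ha. apply Hxy. apply saturate_incl, in_flat_map.
        exists j. split; [apply in_seq; lia|now apply in_map]. }
      split; [|split]; intros a Ha; simpl.
      * assert (G' := G i a (Nat.lt_le_incl _ _ Hi) Ha). lra.
      * assert (G' := G (S i) a Hi Ha).
        pose proof (Hstep i a Hi Ha) as D.
        pose proof (character_dist _ (phi (t i) a) (phi (t (S i)) a)
          (proj2_sig x)) as D'.
        pose proof (norm_sub_trans (proj1_sig x (phi (t i) a))
          (proj1_sig x (phi (t (S i)) a))
          (proj1_sig y (phi (t (S i)) a))). lra.
      * assert (G' := G (S i) a Hi Ha). lra.
Qed.

Fixpoint coef_sum (l : list (Cx * A * A)) : R :=
  match l with
  | [] => 0
  | (z, a, _) :: l' => Cabs z * norm a + coef_sum l'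
  end.

Lemma coef_sum_ge0 l : 0 <= coef_sum l.
Proof.
  induction l as [|[[z a] b] l IH]; simpl; [lra|].
  pose proof (Rmult_le_pos _ _ (Cabs_ge0 z) (norm_ge0 a)). lra.
Qed.

(** Under a character the difference becomes the sum of [c * f a * (f b - f (alpha^g b))]. *)
Lemma ellwood_oscillation (f : A -> A) (l : list (Cx * A * A)) (g : nat) (d : R) :
  character f ->
  (forall b, In b (map snd l) -> norm (sub (f b) (f (act alpha g b))) <= d) ->
  norm (sub (f (ellwood_elt alpha l 0)) (f (ellwood_elt alpha l g))) <= coef_sum l * d.
Proof.
  intros Hf. induction l as [|[[z a] b] l IH]; intros Hd; simpl.
  - rewrite norm_sub_diag. lra.
  - specialize (IH (fun b' H => Hd b' (or_intror H))).
    specialize (Hd b (or_introl eq_refl)).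
    destruct (proj1 Hf) as (Fa & Fs & Fm & _). rewrite !Fa, !Fs, !Fm, sub_add_add.
    eapply Rle_trans; [apply norm_triangle|].
    rewrite Rmult_plus_distr_r. apply Rplus_le_compat; [|exact IH].
    rewrite <- scal_sub, <- mul_sub, norm_scal, Rmult_assoc.
    apply Rmult_le_compat_l; [apply Cabs_ge0|].
    eapply Rle_trans; [apply norm_mul|].
    apply Rmult_le_compat; [apply norm_ge0|apply norm_ge0| |exact Hd].
    now apply character_contractive.
Qed.

(** The Ellwood span approximates the function that is [1] at [0] and [0] elsewhere. If [x] nearly
    agreed with its rotation on the [b]-entries, the values at [0] and [i] would be too close. *)
Lemma uniformly_free :
  free_action k alpha ->
  exists L d, 0 < d /\ forall (x : char_space) i, (0 < i < k)%nat ->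
    ~ (forall a, In a L -> norm (sub (proj1_sig x a) (proj1_sig (Nat.iter i rotate x) a)) <= d).
Proof.
  intros Hfree.
  destruct (Hfree (fun g => match g with O => one | _ => zero end) (1 / 4))
    as (l & Hl); [lra|].
  pose proof (coef_sum_ge0 l) as Hc.
  (* This bounds the oscillation by [1/4]; with two approximation errors below [1/4], the total
     stays below [norm one = 1]. The [+ 1] avoids a zero denominator. *)
  exists (map snd l), (1 / (4 * (coef_sum l + 1))). split.
  - apply Rdiv_lt_0_compat; lra.
  - intros x i Hi Hx.
    assert (Hx' : forall b, In b (map snd l) ->
      norm (sub (proj1_sig x b) (proj1_sig x (act alpha i b)))
        <= 1 / (4 * (coef_sum l + 1))).
    { intros b Hb. rewrite <- rotate_iter. now apply Hx. }
    pose proof (ellwood_oscillation _ l i _ (proj2_sig x) Hx') as O.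
    assert (B : coef_sum l * (1 / (4 * (coef_sum l + 1))) <= 1 / 4).
    { apply (Rmult_le_reg_r (4 * (coef_sum l + 1))); [lra|]. field_simplify; lra. }
    pose proof (Hl 0%nat ltac:(lia)) as L0. cbv beta iota in L0.
    pose proof (Hl i ltac:(lia)) as Li. destruct i as [|i]; [lia|].
    pose proof (character_dist _ one (ellwood_elt alpha l 0) (proj2_sig x)) as D0.
    pose proof (character_dist _ zero (ellwood_elt alpha l (S i)) (proj2_sig x)) as Di.
    destruct (proj1 (proj2_sig x)) as (_ & _ & _ & _ & X1).
    rewrite X1 in D0. rewrite (hom_zero _ (proj1 (proj2_sig x))) in Di.
    rewrite norm_sub_sym in Di.
    pose proof (norm_sub_trans one (proj1_sig x (ellwood_elt alpha l 0))
      (proj1_sig x (ellwood_elt alpha l (S i)))) as T1.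
    pose proof (norm_sub_trans one (proj1_sig x (ellwood_elt alpha l (S i))) zero) as T2.
    rewrite sub_zero, norm_one in T2. lra.
Qed.

Lemma free_colorings :
  free_action k alpha ->
  exists E ss, entourage E /\ Forall (equivariant k rotate) ss /\
    forall x, exists s, In s ss /\ forall y, E x y -> s y = s x.
Proof.
  intros Hfree. destruct (uniformly_free Hfree) as (L & d & Hd & Hsep).
  assert (Hd3 : 0 < d / 3) by lra.
  destruct (locally_constant_colorings k rotate ltac:(lia) rotate_period
    (near (saturate L) (d / 3))) as (ss & Hss & Hin).
  - now apply near_covered.
  - intros x. now apply near_refl.
  (* Three legs of length [d / 3]: from [y] to [x], to [x'], to the rotated [y]. *)
  - intros x x' y i Hi H1 H2 H3. apply (Hsep y i Hi). intros a Ha.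
    apply saturate_incl in Ha. specialize (H1 a Ha). specialize (H2 a Ha).
    specialize (H3 a Ha). rewrite norm_sub_sym in H2.
    pose proof (norm_sub_trans (proj1_sig y a) (proj1_sig x a) (proj1_sig x' a)).
    pose proof (norm_sub_trans (proj1_sig y a) (proj1_sig x' a)
      (proj1_sig (Nat.iter i rotate y) a)). lra.
  - exists (near (saturate L) (d / 3)), ss. repeat split; try easy.
    exists (saturate L), (d / 3). repeat split; [easy|]. apply saturate_stable.
Qed.

End Characters.

Theorem mainTheorem1 (k : nat) (A : CstarAlg) (alpha : A -> A)
  (hk : (2 <= k)%nat)
  (halpha : Zk_action k alpha)
  (hfree : free_action k alpha)
  (phi1 : A -> A)
  (hphi1 : unital_star_hom phi1)
  (hequiv : forall g, (g < k)%nat ->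
     forall a, phi1 (act alpha g a) = act alpha g (phi1 a)) :
  ~ (exists phi : R -> A -> A,
       (forall t, 0 <= t <= 1 -> unital_star_hom (phi t)) /\
       (forall a t, 0 <= t <= 1 -> forall eps, 0 < eps ->
          exists delta, 0 < delta /\
            forall s, 0 <= s <= 1 -> Rabs (s - t) < delta ->
              norm (sub (phi s a) (phi t a)) < eps) /\
       (forall a, phi 1 a = phi1 a) /\
       (forall a, exists c : Cx, phi 0 a = scal c one)).
Proof.
  intros (phi & Hphi & Hc & H1 & H0).
  destruct halpha as [[Halpha _] Hper].
  destruct (free_colorings k alpha hk Halpha Hper hfree) as (E & ss & HE & Hss & Hin).
  assert (h0 : 0 <= 0 <= 1) by lra.
  (* The end of the homotopy is itself the base point. *)
  set (x0 := exist character (phi 0) (conj (Hphi 0 h0) H0)).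
  apply (no_equivariant_contraction k (rotate alpha Halpha) (pullback phi1 hphi1) x0
    (entourage alpha) E ss); auto.
  - now apply rotate_period.
  (* Equivariance for the generator suffices; [hk] is literally [1 < k]. *)
  - intros x. apply char_ext. intros a. simpl.
    f_equal. symmetry. exact (hequiv 1%nat hk a).
  - intros E' (L & e & He & HS & ->) x y Hxy a Ha. apply Hxy. now apply HS.
  - intros E' HE'. now apply (entourage_contraction k alpha hk Hper phi1 hphi1 phi).
Qed.
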